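(* Let $a=\omega^{\omega^{\lambda}}$ be a principal ordinal and $W(a)=\{b: b<a\}$. Every pair of binary operations $(+,\cdot)$ on $W(a)$ satisfying properties (0)–(8) listed in the context is unique up to isomorphism and coincides with the pair consisting of the Hessenberg natural sum and natural product restricted to $W(a)$.
   Context: $W(x)$ denotes the initial segment $\{z:z<x\}$ of ordinals, $s(x)$ the successor of $x$. Two sets of ordinals $A,B$ are called cofinal with each other, written $cf(A)=cf(B)$, if each element of $A$ is $\le$ some element of $B$ and each element of $B$ is $\le$ some element of $A$. Hessenberg operations: if $x=\sum_i\omega^{\xi_i}p_i$, $y=\sum_i\omega^{\xi_i}q_i$ are Cantor normal forms (padded with zero coefficients to have the same exponents), the natural sum is $\sum_i\omega^{\xi_i}(p_i+q_i)$; the natural product is obtained by distributivity and associativity from $\omega^{\xi}\cdot\omega^{\eta}=\omega^{\xi(+)\eta}$, $(+)$ being the natural sum. Properties, for all $x,y,z,x',y',c\in W(a)$: (0) $s(x)=x+1$. (1) $x+y=y+x$, $xy=yx$. (2) $x+(y+z)=(x+y)+z$, $x(yz)=(xy)z$. (3) $x+0=0+x=x$, $x\cdot 0=0$, $x\cdot1=1\cdot x=x$. (4) $x(y+z)=xy+xz$. (5) $x+c=y+c\Rightarrow x=y$; and if $c\ne0$, $xc=yc\Rightarrow x=y$. (6) If $x>y$ and $x'>y'$ then $x+x'>y+y'$ and $xx'+yy'>xy'+yx'$. (7) $cf(W(x+y))=cf\big((W(x)+y)\cup(x+W(y))\big)$. (8) $cf(W(x\cdot y))=cf\big(\{v\in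 W(a): h(v)=h(x)h(y')+h(x')h(y)-h(x')h(y')\text{ for some }x'<x,\ y'<y\}\big)$. In (8), $h$ is the canonical embedding of the additive cancellative monoid $W(a)$ into its Grothendieck group $K(W(a))$ (ordered by $(u,v)\le(u',v')\Leftrightarrow u+v'\le u'+v$), products $h(u)h(v)$ mean $h(u\cdot v)$, and the difference is taken in $K(W(a))$. *)

(* Defs.v *)
From HB Require Import structures.
From mathcomp Require Import all_boot all_order generic_quotient.
From mathcomp Require Import boolp classical_sets.

Set Implicit Arguments.
Unset Strict Implicit.
Unset Printing Implicit Defensive.

Import Order.TTheory.
Local Open Scope classical_set_scope.
Local Open Scope quotient_scope.
Local Open Scope order_scope.

(* [node f] denotes the least ordinal strictly above all the [f i].  Several
   trees denote the same ordinal; [Ord] below is the quotient by this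
   ambiguity. *)
Inductive tree : Type := node (A : Type) (f : A -> tree).

HB.instance Definition _ := gen_eqMixin tree.
HB.instance Definition _ := gen_choiceMixin tree.

Fixpoint tle (x y : tree) : Prop :=
  let: node A f := x in let: node B g := y in
  forall i, exists j, tle (f i) (g j).

Definition tlt (x y : tree) : Prop :=
  let: node B g := y in exists j, tle x (g j).

Definition branches (x : tree) : Type := let: node A f := x in A.
Definition branch (x : tree) : branches x -> tree :=
  let: node A f := x in f.

Definition tzero : tree := node (Empty_set_rect (fun _ => tree)).
Definition tsucc (x : tree) : tree := node (fun _ : unit => x).
(* The least upper bound of the [f i], not a strict one: its branches are those
   of all the [f i]. *)
Definition tsup (A : Type) (f : A -> tree) : tree :=
  node (fun p : {i : A & branches (f i)} => branch (projT2 p)).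
Definition tomega : tree := node (fun n => iter n tsucc tzero).

Fixpoint tadd (x y : tree) : tree :=
  let: node B g := y in
  tsup (fun o : option B => if o is Some j then tsucc (tadd x (g j)) else x).

Fixpoint tmul (x y : tree) : tree :=
  let: node B g := y in tsup (fun j => tadd (tmul x (g j)) x).

(* omega ^ x, as the supremum of 1 and of all omega ^ x' * omega with x' < x. *)
Fixpoint tpow (x : tree) : tree :=
  let: node A f := x in
  tsup (fun o : option A =>
          if o is Some i then tmul (tpow (f i)) tomega else tsucc tzero).

Lemma tle_refl x : tle x x.
Proof. by elim: x => A f IH /= i; exists i. Qed.

Lemma tle_trans y x z : tle x y -> tle y z -> tle x z.
Proof.
elim: x y z => A f IH [B g] [C h] /= xy yz i.
by have [j fg] := xy i; have [k gh] := yz j; exists k; apply: IH gh.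
Qed.

Lemma tltE x y : tlt x y = exists j, tle x (@branch y j).
Proof. by case: y. Qed.

Lemma tleE x y : tle x y <-> forall i, tlt (@branch x i) y.
Proof. by case: x => A f; case: y. Qed.

Lemma tle_or_lt x y : tle x y \/ tlt y x.
Proof.
elim: x y => A f IH [B g] /=.
case: (pselect (exists i, tle (node g) (f i))) => [|nyx]; first by right.
left=> i; apply: contrapT => nj; apply: nyx; exists i; apply/tleE => j /=.
by have [fg|//] := IH i (g j); case: nj; exists j.
Qed.

Arguments tle : simpl never.
Arguments tlt : simpl never.

Lemma tle_lt_trans y x z : tle x y -> tlt y z -> tlt x z.
Proof.
by rewrite !tltE => xy [j yz]; exists j; apply: tle_trans yz.
Qed.

Lemma tlt_le_trans y x z : tlt x y -> tle y z -> tlt x z.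
Proof.
rewrite tltE => -[j xy] /tleE/(_ j); exact: tle_lt_trans.
Qed.

Lemma tlt_irr x : ~ tlt x x.
Proof.
elim: x => A f IH; rewrite tltE => -[i xi]; apply: (IH i).
by apply: (tlt_le_trans _ xi); rewrite tltE; exists i; apply: tle_refl.
Qed.

Lemma tltNle x y : tlt x y <-> ~ tle y x.
Proof.
split=> [xy yx|nyx]; first exact: tlt_irr (tlt_le_trans xy yx).
by have [|] := tle_or_lt y x.
Qed.

Lemma tltW x y : tlt x y -> tle x y.
Proof.
elim: x y => A f IH y xy; apply/tleE => i; move: xy.
rewrite !tltE => -[j /tleE/(_ i) xj]; exists j.
exact: IH.
Qed.

Lemma tle_succ x z : tle (tsucc x) z <-> tlt x z.
Proof. by rewrite tleE; split=> [/(_ tt)|? []]. Qed.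

Lemma tle_sup A (f : A -> tree) z : tle (tsup f) z <-> forall i, tle (f i) z.
Proof.
rewrite tleE; split=> [fz i|fz [i b]].
  by apply/tleE => b; apply: (fz (existT _ i b)).
by have /tleE := fz i; apply.
Qed.

Lemma tle_add x y z :
  tle (tadd x y) z <-> tle x z /\ forall j, tlt (tadd x (@branch y j)) z.
Proof.
case: y => B g /=; rewrite tle_sup; split=> [h|[xz h] [j|//]].
  by split=> [|j]; [apply: (h None)|apply/tle_succ/(h (Some j))].
exact/tle_succ.
Qed.

Lemma tle_mul x y z :
  tle (tmul x y) z <-> forall j, tle (tadd (tmul x (@branch y j)) x) z.
Proof. by case: y => B g /=; rewrite tle_sup. Qed.

Lemma tle_pow x z : tle (tpow x) z <->
  tlt tzero z /\ forall i, tle (tmul (tpow (@branch x i)) tomega) z.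
Proof.
case: x => A f /=; rewrite tle_sup; split=> [h|[z0 h] [i|]//].
  by split=> [|i]; [apply/tle_succ/(h None)|apply: (h (Some i))].
exact/tle_succ.
Qed.

Definition tequiv (x y : tree) : bool := `[< tle x y /\ tle y x >].

Lemma tequiv_refl : reflexive tequiv.
Proof. by move=> x; apply/asboolP; split; apply: tle_refl. Qed.

Lemma tequiv_sym : symmetric tequiv.
Proof. by move=> x y; apply/asbool_equiv_eq; split=> -[]. Qed.

Lemma tequiv_trans : transitive tequiv.
Proof.
move=> y x z /asboolP[xy yx] /asboolP[yz zy]; apply/asboolP.
by split; apply: (@tle_trans y).
Qed.

Canonical tequiv_equiv := EquivRel tequiv tequiv_refl tequiv_sym tequiv_trans.

Definition Ord : Type := {eq_quot tequiv}.
HB.instance Definition _ := Choice.on Ord.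
HB.instance Definition _ := EqQuotient.on Ord.

Definition ole (x y : Ord) : bool := `[< tle (repr x) (repr y) >].

Lemma ole_refl : reflexive ole.
Proof. by move=> x; apply/asboolP/tle_refl. Qed.

Lemma ole_anti : antisymmetric ole.
Proof.
move=> x y /andP[/asboolP xy /asboolP yx].
rewrite -[x]reprK -[y]reprK; apply/eqmodP; exact/asboolP.
Qed.

Lemma ole_trans : transitive ole.
Proof.
move=> y x z /asboolP xy /asboolP yz; apply/asboolP; exact: tle_trans yz.
Qed.

Lemma ole_total : total ole.
Proof.
move=> x y; apply/orP; have [xy|/tltW yx] := tle_or_lt (repr x) (repr y).
  by left; apply/asboolP.
by right; apply/asboolP.
Qed.

Fact Ord_display : Order.disp_t. Proof. exact: Order.Disp tt tt. Qed.
HB.instance Definition _ :=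
  Order.Le_isPOrder.Build Ord_display Ord ole_refl ole_anti ole_trans.
HB.instance Definition _ :=
  Order.POrder_isTotal.Build Ord_display Ord ole_total.

Local Notation "[ 'ord' t ]" := (\pi_({eq_quot tequiv}) t : Ord)
  (format "[ 'ord'  t ]").

Definition ozero : Ord := [ord tzero].
Definition osucc (x : Ord) : Ord := [ord tsucc (repr x)].
Definition oomega : Ord := [ord tomega].
Definition oadd (x y : Ord) : Ord := [ord tadd (repr x) (repr y)].
Definition omul (x y : Ord) : Ord := [ord tmul (repr x) (repr y)].
Definition opow (x : Ord) : Ord := [ord tpow (repr x)].
Definition oone : Ord := osucc ozero.
Definition onat (n : nat) : Ord := iter n osucc ozero.

Lemma repr_ord t : tle (repr [ord t]) t /\ tle t (repr [ord t]).
Proof.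
have /eqmodP/asboolP[] : [ord repr [ord t]] = [ord t] by rewrite reprK.
by split.
Qed.

Lemma le_ord s t : ([ord s] <= [ord t]) <-> tle s t.
Proof.
have [s1 s2] := repr_ord s; have [t1 t2] := repr_ord t.
split=> [/asboolP st|st]; last apply/asboolP.
  exact: tle_trans s2 (tle_trans st t1).
exact: tle_trans s1 (tle_trans st t2).
Qed.

Lemma lt_ord s t : ([ord s] < [ord t]) <-> tlt s t.
Proof.
rewrite ltNge tltNle; split=> [/negP ts /le_ord//|ts]; apply/negP.
by move=> /le_ord.
Qed.

Lemma lt_branch (y : Ord) j : [ord @branch (repr y) j] < y.
Proof. by rewrite -[ltRHS]reprK lt_ord tltE; exists j; apply: tle_refl. Qed.

Lemma lt_branchP (z y : Ord) :
  z < y -> exists j, z <= [ord @branch (repr y) j].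
Proof.
rewrite -[z]reprK -[y in _ < y]reprK lt_ord tltE => -[j zj].
by exists j; apply/le_ord.
Qed.

Lemma le_tadd x x' y y' :
  tle x x' -> tle y y' -> tle (tadd x y) (tadd x' y').
Proof.
move=> xx; elim: y y' => B g IH y' yy.
have [x'y' h] := (tle_add x' y' _).1 (tle_refl _).
apply/tle_add; split=> [|j]; first exact: tle_trans x'y'.
have := (tleE _ _).1 yy j; rewrite tltE => -[k jk].
exact: tle_lt_trans (IH _ _ jk) (h k).
Qed.

Lemma le_tmul x x' y y' :
  tle x x' -> tle y y' -> tle (tmul x y) (tmul x' y').
Proof.
move=> xx; elim: y y' => B g IH y' yy.
have h := (tle_mul x' y' _).1 (tle_refl _).
apply/tle_mul => j.
have := (tleE _ _).1 yy j; rewrite tltE => -[k jk].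
exact: tle_trans (le_tadd (IH _ _ jk) xx) (h k).
Qed.

Lemma le_tpow x x' : tle x x' -> tle (tpow x) (tpow x').
Proof.
elim: x x' => A f IH x' xx.
have [h0 h] := (tle_pow x' _).1 (tle_refl _).
apply/tle_pow; split=> // i.
have := (tleE _ _).1 xx i; rewrite tltE => -[k ik].
exact: tle_trans (le_tmul (IH _ _ ik) (tle_refl _)) (h k).
Qed.

Lemma ord_eqP s t : ([ord s] = [ord t]) <-> tle s t /\ tle t s.
Proof.
split=> [/eqmodP/asboolP//|st]; apply/eqmodP; exact/asboolP.
Qed.

Lemma oaddE s t : oadd [ord s] [ord t] = [ord tadd s t].
Proof.
have [s1 s2] := repr_ord s; have [t1 t2] := repr_ord t.
by apply/ord_eqP; split; apply: le_tadd.
Qed.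

Lemma omulE s t : omul [ord s] [ord t] = [ord tmul s t].
Proof.
have [s1 s2] := repr_ord s; have [t1 t2] := repr_ord t.
by apply/ord_eqP; split; apply: le_tmul.
Qed.

Lemma opowE s : opow [ord s] = [ord tpow s].
Proof. by have [s1 s2] := repr_ord s; apply/ord_eqP; split; apply: le_tpow. Qed.

Lemma osuccE s : osucc [ord s] = [ord tsucc s].
Proof.
have [s1 s2] := repr_ord s.
by apply/ord_eqP; split; apply/tle_succ; rewrite tltE; exists tt.
Qed.

Lemma ole0 (x : Ord) : ozero <= x.
Proof. by rewrite -[x]reprK le_ord tleE; case. Qed.

Lemma le_osucc (x z : Ord) : (osucc x <= z) = (x < z).
Proof.
rewrite -[x]reprK -[z]reprK osuccE; apply/idP/idP.
  by rewrite le_ord lt_ord tle_succ.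
by rewrite le_ord lt_ord tle_succ.
Qed.

Lemma Ord_ind (P : Ord -> Prop) :
  (forall x, (forall y, y < x -> P y) -> P x) -> forall x, P x.
Proof.
move=> IH x; suff: forall t (z : Ord), z <= [ord t] -> P z.
  by move/(_ (repr x)); apply; rewrite reprK.
elim=> A f IHt z zt; apply: IH => y /lt_le_trans/(_ zt).
rewrite -[y in y < _]reprK lt_ord tltE => -[i yi].
by apply: (IHt i); rewrite -[y]reprK le_ord.
Qed.

(* [oadd], [omul] and [opow] are the ordinary, non-commutative ordinal sum and
   product and the power with base omega: the next three equivalences
   characterise them as suprema, uniformly for zero, successor and limit
   arguments. *)
Lemma oadd_le (x y z : Ord) :
  oadd x y <= z <-> x <= z /\ forall y', y' < y -> oadd x y' < z.
Proof.
rewrite -[x]reprK -[z]reprK; split.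
  rewrite -{1}[y]reprK oaddE !le_ord => /tle_add[xz h]; split=> // y'.
  move=> /lt_branchP[j]; rewrite -[y']reprK le_ord oaddE lt_ord => y'j.
  exact: tle_lt_trans (le_tadd (tle_refl _) y'j) (h j).
move=> [xz h]; rewrite -{1}[y]reprK oaddE le_ord; apply/tle_add.
split=> [|j]; first exact/le_ord.
by have := h _ (lt_branch j); rewrite oaddE lt_ord.
Qed.

Lemma omul_le (x y z : Ord) :
  omul x y <= z <-> forall y', y' < y -> oadd (omul x y') x <= z.
Proof.
rewrite -[x]reprK -[z]reprK; split.
  rewrite -{1}[y]reprK omulE le_ord => /tle_mul h y'.
  move=> /lt_branchP[j]; rewrite -[y']reprK le_ord omulE oaddE le_ord => y'j.
  apply: tle_trans (h j).
  by apply: le_tadd (tle_refl _); apply: le_tmul y'j; apply: tle_refl.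
move=> h; rewrite -{1}[y]reprK omulE le_ord; apply/tle_mul => j.
by have := h _ (lt_branch j); rewrite omulE oaddE le_ord.
Qed.

Lemma opow_le (x z : Ord) :
  opow x <= z <->
  oone <= z /\ forall x', x' < x -> omul (opow x') oomega <= z.
Proof.
rewrite -[z]reprK le_osucc lt_ord; split.
  rewrite -{1}[x]reprK opowE le_ord => /tle_pow[z0 h]; split=> // x'.
  move=> /lt_branchP[j]; rewrite -[x']reprK le_ord opowE omulE le_ord => x'j.
  apply: tle_trans (h j).
  by apply: le_tmul (tle_refl _); apply: le_tpow.
move=> [z0 h]; rewrite -{1}[x]reprK opowE le_ord; apply/tle_pow.
split=> [|j]; first by [].
by have := h _ (lt_branch j); rewrite opowE omulE le_ord.
Qed.

Lemma lt_oomega (x : Ord) : x < oomega <-> exists n, x = onat n.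
Proof.
have onatE n : onat n = [ord iter n tsucc tzero].
  by elim: n => //= n ->; rewrite osuccE.
split=> [|[n ->]]; last first.
  by rewrite onatE lt_ord tltE; exists n; apply: tle_refl.
rewrite -[x in x < _]reprK lt_ord tltE => -[n].
rewrite -le_ord reprK [branch _]/= -onatE; elim: n x => [|n IH] x xn.
  by exists 0; apply/le_anti; rewrite xn ole0.
have [xn'|] := leP x (onat n); first exact: IH.
by rewrite -le_osucc => nx; exists n.+1; apply/le_anti; rewrite xn.
Qed.

Lemma opow_gt0 (x : Ord) : ozero < opow x.
Proof. by have [+ _] := (opow_le x _).1 (lexx _); rewrite le_osucc. Qed.

Lemma lt_oadd (x y : Ord) : ozero < y -> x < oadd x y.
Proof.
have [_ h] := (oadd_le x y _).1 (lexx _); move=> /h; apply: le_lt_trans.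
by have [] := (oadd_le x ozero _).1 (lexx _).
Qed.

Lemma opow_gt1 (x : Ord) : ozero < x -> oone < opow x.
Proof.
set u := opow ozero; have u0 : ozero < u := opow_gt0 _.
move=> x0; have [_ /(_ _ x0)] := (opow_le x _).1 (lexx _).
apply: lt_le_trans.
have o1 : oone < oomega by apply/lt_oomega; exists 1.
have h1 := (omul_le u oomega _).1 (lexx _) _ o1; apply: lt_le_trans h1.
apply: le_lt_trans (lt_oadd _ u0); rewrite le_osucc.
have l01 : ozero < oone by rewrite -le_osucc.
have h0 := (omul_le u oone _).1 (lexx _) _ l01; apply: lt_le_trans h0.
exact: le_lt_trans (ole0 _) (lt_oadd _ u0).
Qed.

Definition cnf_eval (s : seq (Ord * nat)) : Ord :=
  foldr (fun t z => oadd (omul (opow t.1) (onat t.2)) z) ozero s.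

Definition is_cnf (x : Ord) (s : seq (Ord * nat)) : Prop :=
  [/\ sorted (fun t u => u.1 < t.1) s, all (fun t => (0 < t.2)%N) s
    & cnf_eval s = x].

(* The list of pairs (exponent, coefficient) of the Cantor normal form of [x];
   there is exactly one list satisfying [is_cnf x], so that the default value
   is never used. *)
Definition cnf (x : Ord) : seq (Ord * nat) := xget [::] [set s | is_cnf x s].

Definition cnf_coef (x xi : Ord) : nat := \sum_(t <- cnf x | t.1 == xi) t.2.

(* Exponents occurring in only one of the two normal forms get coefficient 0 in
   the other one through [cnf_coef]. *)
Definition hadd (x y : Ord) : Ord :=
  let exponents :=
    sort (fun xi eta => eta <= xi) (undup (map fst (cnf x) ++ map fst (cnf y)))
  in cnf_eval [seq (xi, (cnf_coef x xi + cnf_coef y xi)%N) | xi <- exponents].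

Definition hmul (x y : Ord) : Ord :=
  \big[hadd/ozero]_(s <- cnf x) \big[hadd/ozero]_(t <- cnf y)
    omul (opow (hadd s.1 t.1)) (onat (s.2 * t.2)).

Definition W (a : Ord) : Type := {x : Ord | x < a}.
HB.instance Definition _ a := SubChoice.on (W a).
HB.instance Definition _ a :=
  [SubChoice_isSubOrder of W a by <: with Ord_display].

Definition principal (lam : Ord) : Ord := opow (opow lam).

Lemma principal_gt1 lam : oone < principal lam.
Proof. exact/opow_gt1/opow_gt0. Qed.

Lemma principal_gt0 lam : ozero < principal lam.
Proof. exact: opow_gt0. Qed.

Definition W0 (lam : Ord) : W (principal lam) :=
  exist _ ozero (principal_gt0 lam).
Definition W1 (lam : Ord) : W (principal lam) :=
  exist _ oone (principal_gt1 lam).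

Definition cofinal d (T : porderType d) (A B : set T) : Prop :=
  (forall x, A x -> exists2 y, B y & x <= y) /\
  (forall y, B y -> exists2 x, A x & y <= x).

(* The Grothendieck group of a commutative cancellative monoid [T] is presented
   as the setoid of formal differences [(u, v)], read u - v, with equality
   [groth_eq]. *)
Section Grothendieck.
Variables (T : Type) (zero : T) (add : T -> T -> T).

Definition groth_eq (p q : T * T) : Prop := add p.1 q.2 = add q.1 p.2.
Definition groth_embed (u : T) : T * T := (u, zero).
Definition groth_add (p q : T * T) : T * T := (add p.1 q.1, add p.2 q.2).
Definition groth_opp (p : T * T) : T * T := (p.2, p.1).
Definition groth_sub (p q : T * T) : T * T := groth_add p (groth_opp q).

End Grothendieck.

Section Properties.
Variables (lam : Ord).
Local Notation T := (W (principal lam)).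
Variables (add mul : T -> T -> T).
Local Notation "0" := (W0 lam).
Local Notation "1" := (W1 lam).
Local Notation "x + y" := (add x y).
Local Notation "x * y" := (mul x y).
Local Notation h := (groth_embed 0).
Local Notation "p +g q" := (groth_add add p q)
  (at level 50, left associativity).
Local Notation "p -g q" := (groth_sub add p q)
  (at level 50, left associativity).

(* The associativity, commutativity and cancellation clauses make [groth_eq add]
   an equivalence, so that the last clause is an equation in the group. *)
Record hessenberg_properties : Prop := {
  hess_succ : forall x, val (x + 1) = osucc (val x);
  hess_addC : forall x y, x + y = y + x;
  hess_mulC : forall x y, x * y = y * x;
  hess_addA : forall x y z, x + (y + z) = (x + y) + z;
  hess_mulA : forall x y z, x * (y * z) = (x * y) * z;
  hess_addx0 : forall x, x + 0 = x;
  hess_add0x : forall x, 0 + x = x;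
  hess_mulx0 : forall x, x * 0 = 0;
  hess_mulx1 : forall x, x * 1 = x;
  hess_mul1x : forall x, 1 * x = x;
  hess_mulDr : forall x y z, x * (y + z) = x * y + x * z;
  hess_addI : forall x y c, x + c = y + c -> x = y;
  hess_mulI : forall x y c, c <> 0 -> x * c = y * c -> x = y;
  hess_lt_add : forall x y x' y' : T, y < x -> y' < x' -> y + y' < x + x';
  hess_lt_mul : forall x y x' y' : T, y < x -> y' < x' ->
    x * y' + y * x' < x * x' + y * y';
  hess_cof_add : forall x y,
    cofinal [set z : T | z < x + y]
      ([set x' + y | x' in [set x' : T | x' < x]] `|`
       [set x + y' | y' in [set y' : T | y' < y]]);
  hess_cof_mul : forall x y,
    cofinal [set z : T | z < x * y]
      [set v : T | exists x' y' : T, [/\ x' < x, y' < y &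
        groth_eq add (h v) (h (x * y') +g h (x' * y) -g h (x' * y'))]]
}.

End Properties.

Definition isomorphic_ops d (T T' : porderType d)
    (add mul : T -> T -> T) (add' mul' : T' -> T' -> T') : Prop :=
  exists f : T -> T', [/\ bijective f, {mono f : x y / x <= y},
    {morph f : x y / add x y >-> add' x y} &
    {morph f : x y / mul x y >-> mul' x y}].

(* Main.v *)
(* Clauses (7) and (8) determine [x + y] and [x * y] as least strict upper bounds
   of values at smaller arguments.  Cantor normal forms are compared
   lexicographically and [hadd] adds coefficients, so every ordinal below
   [hadd x y] lies below some [hadd x' y] or [hadd x y'] with [x' < x], [y' < y];
   hence [hadd] satisfies the recursion (7) and [add] equals it.  Distributivity
   reduces [mul] to powers of omega.  There, by induction, every [v] of (8) is
   bounded by a sum of two ordinals below [opow (hadd xi eta)], and the product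
   is strictly above all [omega ^ zeta * n] with [zeta < hadd xi eta], so it is
   [opow (hadd xi eta)].  Two pairs of operations thus have the same values, and
   the identity is an isomorphism. *)
Require Import Defs.
From HB Require Import structures.
From mathcomp Require Import all_boot all_order.
From mathcomp Require Import boolp classical_sets.

Set Implicit Arguments.
Unset Strict Implicit.
Unset Printing Implicit Defensive.

Import Order.TTheory.
Local Open Scope order_scope.

(** * Ordinal arithmetic from the supremum characterisations *)

Lemma Ord_min (P : Ord -> Prop) :
  (exists x, P x) -> exists2 x, P x & forall y, y < x -> ~ P y.
Proof.
case=> x; elim/Ord_ind: x => x IH Px.
have [[y [yx Py]]|nP] := pselect (exists y, y < x /\ P y); first exact: IH Py.
by exists x => // y yx Py; apply: nP; exists y.
Qed.

Lemma lt_osucc (x y : Ord) : (x < osucc y) = (x <= y).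
Proof. by rewrite ltNge le_osucc -leNgt. Qed.

Lemma lt0o (x : Ord) : (ozero < x) = (x != ozero).
Proof. by rewrite lt_neqAle ole0 andbT eq_sym. Qed.

Lemma le_oaddr (x y : Ord) : x <= oadd x y.
Proof. by have [] := (oadd_le x y _).1 (lexx _). Qed.

Lemma lt_oadd2l (x : Ord) : {mono oadd x : y z / y < z}.
Proof.
apply: leW_mono; apply: le_mono => y z yz.
by have [_ /(_ _ yz)] := (oadd_le x z _).1 (lexx _).
Qed.

Lemma le_oadd2l (x : Ord) : {mono oadd x : y z / y <= z}.
Proof. by move=> y z; rewrite !leNgt lt_oadd2l. Qed.

Lemma oaddI (x : Ord) : injective (oadd x).
Proof.
move=> y z e; apply/le_anti.
by rewrite -(le_oadd2l x y) -(le_oadd2l x z) e lexx.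
Qed.

Lemma le_oadd2r (x y z : Ord) : x <= y -> oadd x z <= oadd y z.
Proof.
move=> xy; elim/Ord_ind: z => z IH; apply/oadd_le; split=> [|t tz].
  exact: le_trans (le_oaddr _ _).
by apply: le_lt_trans (IH _ tz) _; rewrite lt_oadd2l.
Qed.

Lemma oadd0o (x : Ord) : oadd ozero x = x.
Proof.
elim/Ord_ind: x => x IH; apply/le_anti/andP; split.
  by apply/oadd_le; split=> [|y yx]; rewrite ?ole0 ?IH.
(* If [oadd ozero x < x], induction fixes [oadd ozero x], while strict monotonicity decreases it. *)
rewrite leNgt; apply/negP => lt; have := lt.
by rewrite -{1}(lt_oadd2l ozero) IH // ltxx.
Qed.

Lemma oaddo0 (x : Ord) : oadd x ozero = x.
Proof.
apply/le_anti; rewrite le_oaddr andbT; apply/oadd_le; split=> // y.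
by rewrite ltNge ole0.
Qed.

Lemma osubP (x y : Ord) : x <= y -> exists z, oadd x z = y.
Proof.
move=> xy; have [|z yz minz] := @Ord_min (fun z => y <= oadd x z).
  by exists y; rewrite -{1}[y]oadd0o le_oadd2r ?ole0.
exists z; apply/le_anti; rewrite yz andbT; apply/oadd_le; split=> // t tz.
by rewrite ltNge; apply/negP/minz.
Qed.

Lemma le_omul2l (x y z : Ord) : y <= z -> omul x y <= omul x z.
Proof.
move=> yz; apply/omul_le => t ty.
by apply: ((omul_le x z _).1 (lexx _)); apply: lt_le_trans ty yz.
Qed.

Lemma le_omul2r (x y z : Ord) : x <= y -> omul x z <= omul y z.
Proof.
move=> xy; elim/Ord_ind: z => z IH; apply/omul_le => t tz.
apply: le_trans ((omul_le y z _).1 (lexx _) _ tz).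
apply: le_trans (le_oadd2r _ (IH _ tz)) _.
by rewrite le_oadd2l.
Qed.

Lemma omulo0 (x : Ord) : omul x ozero = ozero.
Proof.
by apply/le_anti; rewrite ole0 andbT; apply/omul_le => y; rewrite ltNge ole0.
Qed.

Lemma omuloS (x y : Ord) : omul x (osucc y) = oadd (omul x y) x.
Proof.
apply/le_anti/andP; split.
  apply/omul_le => z; rewrite lt_osucc => zy.
  exact/le_oadd2r/le_omul2l.
by apply: ((omul_le x _ _).1 (lexx _)); rewrite lt_osucc.
Qed.

Lemma omul_oomega_le (x z : Ord) :
  omul x oomega <= z <-> forall n, omul x (onat n.+1) <= z.
Proof.
rewrite omul_le; split=> [h n|h y /lt_oomega[n ->]].
  by rewrite [onat _]/= omuloS; apply: h; apply/lt_oomega; exists n.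
by rewrite -omuloS; apply: (h n).
Qed.

Lemma le_onat : {homo onat : m n / (m <= n)%N >-> m <= n}.
Proof.
move=> m n /subnK <-; elim: (n - m)%N => // k /le_trans; apply.
by rewrite ltW // lt_osucc.
Qed.

Lemma omul_opow_lt (x y : Ord) n :
  x < y -> omul (opow x) (onat n) < opow y.
Proof.
move=> xy; have [_ /(_ _ xy)/omul_oomega_le/(_ n)] := (opow_le y _).1 (lexx _).
by apply: lt_le_trans; rewrite omuloS lt_oadd ?opow_gt0.
Qed.

Lemma omulo1 (x : Ord) : omul x (onat 1) = x.
Proof. by rewrite omuloS omulo0 oadd0o. Qed.

Lemma lt_opow : {mono opow : x y / x < y}.
Proof.
apply: leW_mono; apply: le_mono => x y xy.
by rewrite -[opow x]omulo1 omul_opow_lt.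
Qed.

Lemma le_opow : {mono opow : x y / x <= y}.
Proof. by move=> x y; rewrite !leNgt lt_opow. Qed.

(** If [opow x < x], then [opow x] is a smaller counterexample, as [opow] is strictly increasing. *)
Lemma le_opow_self (x : Ord) : x <= opow x.
Proof.
elim/Ord_ind: x => x IH; rewrite leNgt; apply/negP => lt.
by have := IH _ lt; rewrite le_opow leNgt lt.
Qed.

(** * Padded Cantor normal forms and lexicographic comparison *)

Lemma gt_sorted_uniq_ge (s : seq Ord) :
  sorted >%O s = uniq s && sorted >=%O s.
Proof. exact: (@lt_sorted_uniq_le _ Ord^d). Qed.

(* The value of a Cantor normal form whose exponents are listed in [E], with
   zero coefficients allowed: any two ordinals can then be written with the same
   exponents. *)
Definition ceval (E : seq Ord) (f : Ord -> nat) : Ord :=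
  cnf_eval [seq (xi, f xi) | xi <- E].

Lemma ceval_cons e E f :
  ceval (e :: E) f = oadd (omul (opow e) (onat (f e))) (ceval E f).
Proof. by []. Qed.

(** Bounding the tail by one more copy of the leading power leaves a finite multiple of that power,
    still below [opow e]. This is what makes comparison lexicographic. *)
Lemma ceval_lt_opow e E f : path >%O e E -> ceval E f < opow e.
Proof.
elim: E e => [|e' E IH] e /=; first by rewrite opow_gt0.
case/andP=> e'e /IH lt; rewrite ceval_cons.
apply: lt_trans (omul_opow_lt (f e').+1 e'e).
by rewrite omuloS lt_oadd2l.
Qed.

Lemma ceval_lt_head e E f g : path >%O e E -> (f e < g e)%N ->
  ceval (e :: E) f < ceval (e :: E) g.
Proof.
move=> eE fg; rewrite !ceval_cons; apply: lt_le_trans (le_oaddr _ _).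
apply: lt_le_trans (le_omul2l _ (le_onat fg)).
by rewrite omuloS lt_oadd2l ceval_lt_opow.
Qed.

Lemma ceval_lt E f g : sorted >%O E ->
  ceval E f < ceval E g <->
  exists xi, [/\ xi \in E, (f xi < g xi)%N
    & {in E, forall eta, xi < eta -> f eta = g eta}].
Proof.
elim: E => [|e E IH] /= sE; first by rewrite ltxx; split=> // -[xi []].
have eE eta : eta \in E -> eta < e.
  by move: eta; apply/allP/(order_path_min _ sE) => x y z /= yx /lt_trans; apply.
have [fg|gf|fg] := ltngtP (f e) (g e).
- rewrite ceval_lt_head //; split=> // _; exists e; split=> //.
    by rewrite mem_head.
  by move=> eta /predU1P[->|/eE/lt_gtF->//]; rewrite ltxx.
- have /lt_gtF -> := ceval_lt_head sE gf; split=> // -[xi []].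
  rewrite inE => /predU1P[->|/eE xe _ /(_ e (mem_head _ _) xe) fg].
    by rewrite ltnNge ltnW.
  by rewrite fg ltnn in gf.
- rewrite !ceval_cons fg lt_oadd2l (IH (path_sorted sE)).
  split=> -[xi [xE lt h]]; exists xi; split=> //.
  + by rewrite inE xE orbT.
  + by move=> eta /predU1P[->//|]; apply: h.
  + by move: xE lt; rewrite inE => /predU1P[->|//]; rewrite fg ltnn.
  + by move=> eta etaE; apply: h; rewrite inE etaE orbT.
Qed.

Lemma eq_ceval E f g : {in E, f =1 g} -> ceval E f = ceval E g.
Proof.
by move=> fg; congr cnf_eval; apply/eq_in_map => xi /fg ->.
Qed.

Lemma ceval_inj E f g :
  sorted >%O E -> ceval E f = ceval E g -> {in E, f =1 g}.
Proof.
elim: E => [//|e E IH] /= sE fg.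
have efg : f e = g e.
  by case: (ltngtP (f e) (g e)) => // /(ceval_lt_head sE); rewrite fg ltxx.
move=> xi /predU1P[->//|]; apply: IH; first exact: path_sorted sE.
by move: fg; rewrite !ceval_cons efg => /oaddI.
Qed.

Lemma ceval_filter E f : ceval [seq xi <- E | f xi != 0%N] f = ceval E f.
Proof.
elim: E => //= e E IH; rewrite ceval_cons -IH.
by have [->|//] := eqVneq (f e) 0%N; rewrite /= omulo0 oadd0o.
Qed.

(** Without zero terms both lists have the same entries, which determine a strictly decreasing
    list. *)
Lemma ceval_pad E E' f : sorted >%O E -> sorted >%O E' ->
  (forall xi, f xi != 0%N -> (xi \in E) = (xi \in E')) ->
  ceval E f = ceval E' f.
Proof.
move=> sE sE' EE'; rewrite -ceval_filter -[RHS]ceval_filter.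
have gtT : transitive (>%O : rel Ord) by move=> x y z /= yx /lt_trans; apply.
congr (ceval _ f); apply: (irr_sorted_eq gtT) => [x|||xi].
- exact: ltxx.
- exact: sorted_filter.
- exact: sorted_filter.
- by rewrite !mem_filter; case: eqP => //= /eqP; apply: EE'.
Qed.

(** * Existence of normal forms, and coefficient functions *)

(** Division by a power: some [e' < e] has [x] below [opow e'] times omega, and subtracting the
    largest possible multiple of [opow e'] leaves a remainder below [opow e'], covered by induction
    on [e]. *)
Lemma cnf_below (e x : Ord) : x < opow e -> exists s,
  [/\ path >%O e (map fst s), all (fun t => (0 < t.2)%N) s & cnf_eval s = x].
Proof.
elim/Ord_ind: e x => e IH x xe.
have [->|] := eqVneq x ozero; first by exists [::].
rewrite -lt0o -le_osucc => x1.
(* Otherwise [x] would bound all the terms whose supremum is [opow e]. *)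
have [e' [e'e /negP xw]] : exists e', e' < e /\ ~ (omul (opow e') oomega <= x).
  apply: contrapT => n; move: xe; rewrite ltNge => /negP; apply.
  apply/opow_le; split=> // e' e'e; apply: contrapT => ?; apply: n.
  by exists e'.
have [n] : exists n, ~ (omul (opow e') (onat n.+1) <= x).
  by apply: contrapT => n; case/negP: xw; apply/omul_oomega_le => k;
    apply: contrapT => ?; apply: n; exists k.
(* Descent to the least [n] with [x] below [n.+1] copies of [opow e']: this is the coefficient of
   [e'], and the term is omitted when it is zero. *)
elim: n => [|n IHn]; move=> /negP; rewrite -ltNge.
  rewrite omulo1 => /IH[//|s [ps s0 <-]]; exists s; split=> //.
  case: s ps {s0} => //= t s /andP[te ->]; rewrite andbT.
  exact: lt_trans te e'e.
rewrite omuloS => xn.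
have [nx|] := leP (omul (opow e') (onat n.+1)) x; last first.
  by move=> xn'; apply: IHn; apply/negP; rewrite -ltNge.
have [r xr] := osubP nx; rewrite -xr lt_oadd2l in xn.
have [s [ps s0 sr]] := IH e' e'e r xn.
by exists ((e', n.+1) :: s); rewrite /= ?e'e ?sr.
Qed.

Lemma cnfP x : is_cnf x (cnf x).
Proof.
apply: (@xgetPex _ [::] [set s | is_cnf x s]%classic).
have [|s [ps s0 sx]] := @cnf_below (osucc x) x.
  by apply: lt_le_trans (le_opow_self _); rewrite lt_osucc.
exists s; split=> //.
by have := path_sorted ps; rewrite sorted_map.
Qed.

Definition exps (x : Ord) : seq Ord := map fst (cnf x).

Lemma exps_sorted x : sorted >%O (exps x).
Proof. by have [h _ _] := cnfP x; rewrite sorted_map. Qed.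

Lemma exps_uniq x : uniq (exps x).
Proof. by have := exps_sorted x; rewrite gt_sorted_uniq_ge => /andP[]. Qed.

Lemma cnf_coefE x t : t \in cnf x -> cnf_coef x t.1 = t.2.
Proof.
move=> tx; rewrite /cnf_coef (perm_big _ (perm_to_rem tx)) big_cons eqxx.
rewrite big1_seq; first exact: addn0.
move=> u /andP[/eqP ut].
have := exps_uniq x; rewrite /exps (perm_uniq (perm_map fst (perm_to_rem tx))).
by rewrite /= -ut => /andP[/negP nu _] urem; case: nu; apply: map_f.
Qed.

Lemma cnf_coef_eq0 x xi : (cnf_coef x xi == 0%N) = (xi \notin exps x).
Proof.
apply/idP/idP; last first.
  move=> nxi; apply/eqP; rewrite /cnf_coef big1_seq // => t /andP[/eqP txi tx].
  by case/negP: nxi; rewrite -txi; apply: map_f.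
apply: contraL => /mapP[t tx ->]; rewrite cnf_coefE // -lt0n.
by have [_ /allP/(_ _ tx)] := cnfP x.
Qed.

Lemma ceval_exps x : ceval (exps x) (cnf_coef x) = x.
Proof.
have [_ _ xE] := cnfP x; rewrite -[RHS]xE /ceval /exps -map_comp.
congr cnf_eval; rewrite -[RHS]map_id; apply/eq_in_map => -[xi n] /= tx.
by rewrite (cnf_coefE tx).
Qed.

Lemma ceval_cnf_coef E x :
  sorted >%O E -> {subset exps x <= E} -> ceval E (cnf_coef x) = x.
Proof.
move=> sE xE; rewrite -[RHS]ceval_exps; apply: ceval_pad => // [|xi].
  exact: exps_sorted.
by rewrite cnf_coef_eq0 negbK => xix; rewrite xix xE.
Qed.

Lemma desc_cover (s : seq Ord) : exists2 E, sorted >%O E & E =i s.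
Proof.
exists (sort >=%O (undup s)) => [|xi]; last by rewrite mem_sort mem_undup.
rewrite gt_sorted_uniq_ge sort_uniq undup_uniq sort_sorted //.
by move=> x y; apply: le_total.
Qed.

(** Both sides are coefficients of the same ordinal; [ceval_inj] identifies them over a list [E']
    containing [xi] and the exponents of both. *)
Lemma cnf_coef_ceval E f xi : sorted >%O E ->
  cnf_coef (ceval E f) xi = if xi \in E then f xi else 0%N.
Proof.
move=> sE; set x := ceval E f; set g := fun xi => if xi \in E then f xi else 0%N.
have [E' sE' E'P] := desc_cover (xi :: E ++ exps x).
rewrite -[RHS]/(g xi); apply: (@ceval_inj E' _ _ sE'); last first.
  by rewrite E'P mem_head.
rewrite ceval_cnf_coef => [|//|eta]; last first.
  by rewrite E'P inE mem_cat => ->; rewrite !orbT.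
rewrite /x (@eq_ceval E f g) => [|eta]; last by rewrite /g => ->.
apply: ceval_pad => // eta; rewrite /g; case: ifP => // etaE _.
by rewrite E'P inE mem_cat etaE orbT.
Qed.

Lemma lt_cnf_coef x y : x < y <-> exists2 xi,
  (cnf_coef x xi < cnf_coef y xi)%N
  & forall eta, xi < eta -> cnf_coef x eta = cnf_coef y eta.
Proof.
have [E sE EP] := desc_cover (exps x ++ exps y).
have xE : {subset exps x <= E} by move=> e; rewrite EP mem_cat => ->.
have yE : {subset exps y <= E} by move=> e; rewrite EP mem_cat orbC => ->.
rewrite -{1}(ceval_cnf_coef sE xE) -{1}(ceval_cnf_coef sE yE) (ceval_lt _ _ sE).
split=> [[xi [xiE lt h]]|[xi lt h]]; exists xi => //.
  move=> eta lte; have [etaE|etaE] := boolP (eta \in E); first exact: h.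
  have /eqP -> : cnf_coef x eta == 0%N.
    by rewrite cnf_coef_eq0; apply: contra etaE; apply: xE.
  apply/esym/eqP.
  by rewrite cnf_coef_eq0; apply: contra etaE; apply: yE.
split=> // [|eta _]; last exact: h.
apply: yE; have := leq_ltn_trans (leq0n _) lt; rewrite lt0n cnf_coef_eq0.
by rewrite negbK.
Qed.

Lemma cnf_coef_inj : injective cnf_coef.
Proof.
move=> x y xy; apply/le_anti; rewrite !leNgt.
by apply/andP; split; apply/negP => /lt_cnf_coef[xi]; rewrite xy ltnn.
Qed.

Lemma le_cnf_coef x y :
  (forall xi, (cnf_coef x xi <= cnf_coef y xi)%N) -> x <= y.
Proof.
by move=> xy; rewrite leNgt; apply/negP => /lt_cnf_coef[xi]; rewrite ltnNge xy.
Qed.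

Lemma cnf_coef0 xi : cnf_coef ozero xi = 0%N.
Proof. exact: (@cnf_coef_ceval [::] (fun=> 0%N) xi). Qed.

Lemma cnf_coef_omul_opow e n xi :
  cnf_coef (omul (opow e) (onat n)) xi = if xi == e then n else 0%N.
Proof.
have := @cnf_coef_ceval [:: e] (fun=> n) xi erefl.
by rewrite ceval_cons oaddo0 inE.
Qed.

Lemma cnf_coef_opow e xi : cnf_coef (opow e) xi = (xi == e).
Proof. by rewrite -[opow e]omulo1 cnf_coef_omul_opow; case: eqP. Qed.

Lemma lt_opow_coef x e :
  x < opow e <-> forall xi, cnf_coef x xi != 0%N -> xi < e.
Proof.
split=> [/lt_cnf_coef[xi]|h].
  rewrite cnf_coef_opow; case: eqVneq => // -> xe h eta; rewrite ltNge.
  apply: contra; rewrite le_eqVlt => /predU1P[<-|lt]; first by case: cnf_coef xe.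
  by rewrite h // cnf_coef_opow (gt_eqF lt).
have h0 xi : e <= xi -> cnf_coef x xi = 0%N.
  by move=> exi; apply/eqP; apply: contraLR exi => /h; rewrite ltNge.
apply/lt_cnf_coef; exists e; rewrite ?cnf_coef_opow ?eqxx ?h0 //.
by move=> eta lt; rewrite cnf_coef_opow (gt_eqF lt) h0 // ltW.
Qed.

(** * The natural sum, coefficientwise *)

Lemma cnf_coef_hadd x y xi :
  cnf_coef (hadd x y) xi = (cnf_coef x xi + cnf_coef y xi)%N.
Proof.
rewrite /hadd -/(exps x) -/(exps y); set E := sort _ _.
have sE : sorted >%O E.
  rewrite gt_sorted_uniq_ge sort_uniq undup_uniq sort_sorted //.
  by move=> u v; apply: le_total.
have -> := @cnf_coef_ceval E (fun xi => cnf_coef x xi + cnf_coef y xi)%N xi sE.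
rewrite mem_sort mem_undup mem_cat; case: ifP => // /norP[].
by rewrite -!cnf_coef_eq0 => /eqP -> /eqP ->.
Qed.

Lemma haddA : associative hadd.
Proof.
by move=> x y z; apply/cnf_coef_inj/funext => xi; rewrite !cnf_coef_hadd addnA.
Qed.

Lemma haddC : commutative hadd.
Proof.
by move=> x y; apply/cnf_coef_inj/funext => xi; rewrite !cnf_coef_hadd addnC.
Qed.

Lemma hadd0o : left_id ozero hadd.
Proof.
move=> x; apply/cnf_coef_inj/funext => xi.
by rewrite cnf_coef_hadd cnf_coef0 add0n.
Qed.

HB.instance Definition _ :=
  Monoid.isComLaw.Build Ord ozero hadd haddA haddC hadd0o.

Lemma lt_hadd2r x y z : x < y -> hadd x z < hadd y z.
Proof.
move=> /lt_cnf_coef[xi lt h]; apply/lt_cnf_coef; exists xi => [|eta /h].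
  by rewrite !cnf_coef_hadd ltn_add2r.
by rewrite !cnf_coef_hadd => ->.
Qed.

Lemma le_haddl x y : x <= hadd x y.
Proof. by apply: le_cnf_coef => xi; rewrite cnf_coef_hadd leq_addr. Qed.

(** Natural addition creates no new exponents. *)
Lemma hadd_lt_opow x y e : x < opow e -> y < opow e -> hadd x y < opow e.
Proof.
move=> /lt_opow_coef xe /lt_opow_coef ye; apply/lt_opow_coef => xi.
by rewrite cnf_coef_hadd addn_eq0 negb_and => /orP[/xe|/ye].
Qed.

(* At the top exponent [xi] where [z] and [hadd x y] differ, one of [x], [y] has
   a positive coefficient; decrement it and replace the lower coefficients by
   those of [z]. *)
Lemma lt_hadd_split x y z : z < hadd x y ->
  (exists2 x', x' < x & z <= hadd x' y) \/ (exists2 y', y' < y & z <= hadd x y').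
Proof.
move=> /lt_cnf_coef[xi]; rewrite cnf_coef_hadd => lt h.
wlog x0 : x y lt h / (0 < cnf_coef x xi)%N => [IH|].
  have [x0|x0] := posnP (cnf_coef x xi); last exact: IH.
  rewrite addnC haddC in lt h; have [] := IH _ _ lt h.
  - by rewrite x0 addn0 in lt; apply: leq_ltn_trans lt.
  - by case=> t; rewrite haddC; right; exists t.
  - by case=> t; rewrite haddC; left; exists t.
left; pose f eta := if eta == xi then (cnf_coef x xi).-1 else
  if xi < eta then cnf_coef x eta else cnf_coef z eta.
have [E sE EP] := desc_cover (xi :: exps x ++ exps z).
have coef0 u eta : eta \notin exps u -> cnf_coef u eta = 0%N.
  by rewrite -cnf_coef_eq0 => /eqP.
have fE eta : cnf_coef (ceval E f) eta = f eta.
  rewrite cnf_coef_ceval // EP inE mem_cat; case: ifP => // /norP[].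
  rewrite /f => /negPf -> /norP[ex ez].
  by case: ifP; rewrite coef0.
exists (ceval E f).
  apply/lt_cnf_coef; exists xi => [|eta lte]; rewrite fE /f ?eqxx ?prednK //.
  by rewrite gt_eqF // lte.
(* The strict inequality [lt] absorbs the decrement at [xi]; above [xi] the new sum agrees with
   [z]. *)
apply: le_cnf_coef => eta; rewrite cnf_coef_hadd fE /f.
case: eqVneq => [->|ne]; first by rewrite -ltnS -addSn prednK.
by case: ifP => [/h ->|_]; rewrite ?cnf_coef_hadd ?leq_addr.
Qed.

Lemma omul_opow_nat e n :
  omul (opow e) (onat n) = iter n (hadd (opow e)) ozero.
Proof.
apply/cnf_coef_inj/funext => xi; rewrite cnf_coef_omul_opow.
elim: n => [|n IH] /=; first by rewrite cnf_coef0; case: ifP.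
by rewrite cnf_coef_hadd -IH cnf_coef_opow; case: eqP.
Qed.

Lemma cnf_coef_sum (s : seq (Ord * nat)) (F : Ord * nat -> Ord) xi :
  cnf_coef (\big[hadd/ozero]_(t <- s) F t) xi = \sum_(t <- s) cnf_coef (F t) xi.
Proof.
exact: (big_morph (cnf_coef^~ xi) (fun x y => cnf_coef_hadd x y xi)
  (cnf_coef0 xi)).
Qed.

(** Rewrites the normal form as a natural sum, on which additive maps act term by term. *)
Lemma hadd_cnf x :
  \big[hadd/ozero]_(t <- cnf x) omul (opow t.1) (onat t.2) = x.
Proof.
apply/cnf_coef_inj/funext => xi; rewrite cnf_coef_sum /cnf_coef big_mkcond.
rewrite [RHS]big_mkcond; apply: eq_bigr => t _.
by rewrite -/(cnf_coef _ _) cnf_coef_omul_opow eq_sym.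
Qed.

Lemma cnf_coef_iter n x xi :
  cnf_coef (iter n (hadd x) ozero) xi = (n * cnf_coef x xi)%N.
Proof.
by elim: n => [|n IH] /=; rewrite ?cnf_coef0 // cnf_coef_hadd IH mulSn.
Qed.

(** * Operations with the given properties: the sum *)

Section HessenbergProperties.

Variables (lam : Ord).
Local Notation T := (W (principal lam)).
Variables (add mul : T -> T -> T).
Hypothesis add_mulP : hessenberg_properties add mul.

(* Junk value [0] outside [W (principal lam)]. *)
Let inW (x : Ord) : T := insubd (W0 lam) x.

Let inWK x : x < principal lam -> val (inW x) = x.
Proof. by move=> xW; rewrite /inW val_insubd xW. Qed.

Let ltW_val (x y : T) : (x < y) = (val x < val y).
Proof. by rewrite ltEsub. Qed.

Let leW_val (x y : T) : (x <= y) = (val x <= val y).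
Proof. by rewrite leEsub. Qed.

Lemma W_ind (P : T -> Prop) :
  (forall x, (forall y, y < x -> P y) -> P x) -> forall x, P x.
Proof.
move=> IH x; suff: forall u (y : T), val y = u -> P y by move/(_ (val x)); apply.
elim/Ord_ind => u IHu y yu; apply: IH => z; rewrite ltW_val yu => zu.
exact: IHu zu z erefl.
Qed.

Lemma val_add x y : val (add x y) = hadd (val x) (val y).
Proof.
elim/W_ind: x y => x IHx y; elim/W_ind: y => y IHy.
have [cof1 cof2] := hess_cof_add add_mulP x y.
apply/le_anti/andP; split; rewrite leNgt; apply/negP => lt.
  (* A natural sum below [add x y] would be bounded by some [add z y] or [add x z] with a smaller
     argument, by induction a smaller natural sum. *)
  have zT : hadd (val x) (val y) < principal lam := lt_trans lt (valP (add x y)).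
  have [|w] := cof1 (inW (hadd (val x) (val y))).
    by rewrite /= ltW_val inWK.
  move=> [|] [z /= zlt <-]; rewrite leW_val inWK // leNgt.
    by rewrite IHx // lt_hadd2r // -ltW_val.
  by rewrite IHy // ![hadd (val x) _]haddC lt_hadd2r // -ltW_val.
(* Conversely, [add x y] is at most a natural sum with one argument decreased; by induction this is
   a value of [add], which cofinality puts strictly below [add x y]. *)
have [[z zlt]|[z zlt]] := lt_hadd_split lt.
  have zW := inWK (lt_trans zlt (valP x)).
  have zx : inW z < x by rewrite ltW_val zW.
  rewrite -zW -IHx // -leW_val leNgt; case/negP.
  have [|w /= wlt /le_lt_trans->//] := cof2 (add (inW z) y).
  by left; exists (inW z).
have zW := inWK (lt_trans zlt (valP y)).
have zy : inW z < y by rewrite ltW_val zW.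
rewrite -zW -IHy // -leW_val leNgt; case/negP.
have [|w /= wlt /le_lt_trans->//] := cof2 (add x (inW z)).
by right; exists (inW z).
Qed.

Let split_inW x a b : val x = hadd a b -> x = add (inW a) (inW b).
Proof.
move=> xab; apply: val_inj; rewrite val_add !inWK //.
  by apply: le_lt_trans (valP x); rewrite xab haddC le_haddl.
by apply: le_lt_trans (valP x); rewrite xab le_haddl.
Qed.

(** * Additive maps and their values on powers of omega *)

Section AdditiveMap.

(** Stands for [fun x => val (mul x y)] with [y] fixed, additive by distributivity. *)
Variable G : T -> Ord.
Hypothesis G0 : G (W0 lam) = ozero.
Hypothesis GD : forall x y, G (add x y) = hadd (G x) (G y).

Lemma additive_omul_opow e n x : val x = omul (opow e) (onat n) ->
  G x = iter n (hadd (G (inW (opow e)))) ozero.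
Proof.
elim: n x => [|n IH] x.
  by rewrite omulo0 => x0; rewrite (_ : x = W0 lam) //; apply: val_inj.
rewrite omul_opow_nat [iter _ _ _]/= -omul_opow_nat => xn.
rewrite (split_inW xn) GD; congr hadd; apply: IH; rewrite inWK //.
by apply: le_lt_trans (valP x); rewrite xn haddC le_haddl.
Qed.

Lemma additive_cnf x : G x =
  \big[hadd/ozero]_(t <- cnf (val x)) iter t.2 (hadd (G (inW (opow t.1)))) ozero.
Proof.
have := esym (hadd_cnf (val x)); move: (cnf (val x)) => s.
elim: s x => [|t s IH] x; rewrite ?big_nil ?big_cons => xs.
  by rewrite (_ : x = W0 lam) //; apply: val_inj.
have lt := valP x; rewrite [X in X < _]xs in lt.
rewrite (split_inW xs) GD; congr hadd.
  apply: additive_omul_opow; rewrite inWK //.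
  by apply: le_lt_trans lt; rewrite le_haddl.
apply: IH; rewrite inWK //.
by apply: le_lt_trans lt; rewrite haddC le_haddl.
Qed.

(** All exponents of [x] are below [xi], so [G x] is a finite natural sum of ordinals below
    [opow zeta]. *)
Lemma additive_lt_opow xi zeta x :
  (forall xi', xi' < xi -> G (inW (opow xi')) < opow zeta) ->
  val x < opow xi -> G x < opow zeta.
Proof.
move=> Glt /lt_opow_coef xlt; rewrite additive_cnf big_seq.
apply: (big_ind (fun z => z < opow zeta)) => [||t tx].
- exact: opow_gt0.
- by move=> u v; apply: hadd_lt_opow.
have /Glt : t.1 < xi by apply: xlt; rewrite cnf_coef_eq0 negbK map_f.
move=> lt; elim: t.2 => [|n IH] /=; first exact: opow_gt0.
exact: hadd_lt_opow.
Qed.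

End AdditiveMap.

(** * The product, first on powers of omega *)

Let mull0 y : mul (W0 lam) y = W0 lam.
Proof. by rewrite (hess_mulC add_mulP) (hess_mulx0 add_mulP). Qed.

Let val_mull0 y : val (mul (W0 lam) y) = ozero.
Proof. by rewrite mull0. Qed.

Let val_mulDl y x x' :
  val (mul (add x x') y) = hadd (val (mul x y)) (val (mul x' y)).
Proof.
rewrite -val_add (hess_mulC add_mulP) (hess_mulDr add_mulP).
by rewrite !(hess_mulC add_mulP y).
Qed.

(** The inequality [hess_lt_mul] with zero as the smaller second factor. *)
Lemma lt_mul2r x x' y : W0 lam < y -> x' < x -> mul x' y < mul x y.
Proof.
move=> y0 xx'; have := hess_lt_mul add_mulP xx' y0.
by rewrite !(hess_mulx0 add_mulP) (hess_add0x add_mulP) (hess_addx0 add_mulP).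
Qed.

Let W0_lt_opow e : opow e < principal lam -> W0 lam < inW (opow e).
Proof. by move=> eW; rewrite ltW_val inWK // opow_gt0. Qed.

(** Finite multiples of [opow xi'] are below [opow xi]; additivity and strict monotonicity carry
    this to products with [y]. *)
Lemma omul_oomega_le_mul xi' xi zeta y :
  xi' < xi -> opow xi < principal lam -> W0 lam < y ->
  val (mul (inW (opow xi')) y) = opow zeta ->
  omul (opow zeta) oomega <= val (mul (inW (opow xi)) y).
Proof.
move=> lt xiW y0 zetaE; apply/omul_oomega_le => n.
have ltn := omul_opow_lt n.+1 lt; have nW := inWK (lt_trans ltn xiW).
have := additive_omul_opow (val_mull0 y) (val_mulDl y) nW.
rewrite zetaE -omul_opow_nat => <-; rewrite -leW_val ltW // lt_mul2r //.
by rewrite ltW_val nW inWK.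
Qed.

Lemma mul_opow xi eta :
  opow xi < principal lam -> opow eta < principal lam ->
  val (mul (inW (opow xi)) (inW (opow eta))) = opow (hadd xi eta).
Proof.
elim/Ord_ind: xi eta => xi IHxi eta; elim/Ord_ind: eta => eta IHeta xiW etaW.
have xiT : forall xi', xi' < xi -> opow xi' < principal lam.
  by move=> xi' lt; apply: lt_trans xiW; rewrite lt_opow.
have etaT : forall eta', eta' < eta -> opow eta' < principal lam.
  by move=> eta' lt; apply: lt_trans etaW; rewrite lt_opow.
set x := inW (opow xi); set y := inW (opow eta).
have x0 : W0 lam < x := W0_lt_opow xiW.
have y0 : W0 lam < y := W0_lt_opow etaW.
(* Any [zeta < hadd xi eta] is at most some [hadd xi' eta] or [hadd xi eta'], where induction gives
   the product. *)
have ge : opow (hadd xi eta) <= val (mul x y).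
  apply/opow_le; split.
    by rewrite le_osucc; have := lt_mul2r y0 x0; rewrite mull0 ltW_val.
  move=> zeta /lt_hadd_split[[xi' lt le]|[eta' lt le]].
    apply: le_trans (omul_oomega_le_mul lt xiW y0 (IHxi _ lt _ (xiT _ lt) etaW)).
    by apply: le_omul2r; rewrite le_opow.
  have := IHeta _ lt xiW (etaT _ lt); rewrite (hess_mulC add_mulP) => e.
  rewrite (hess_mulC add_mulP).
  apply: le_trans (omul_oomega_le_mul lt etaW x0 e).
  by apply: le_omul2r; rewrite le_opow.
apply/le_anti; rewrite ge andbT leNgt; apply/negP => lt.
have zW := inWK (lt_trans lt (valP (mul x y))).
have [cof _] := hess_cof_mul add_mulP x y.
have [|v [x' [y' [x'x y'y]]]] := cof (inW (opow (hadd xi eta))).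
  by rewrite /= ltW_val zW.
(* In the group the condition on [v] unfolds to [add v (mul x' y') = add (mul x y') (mul x' y)], so
   the right side bounds [v]. *)
rewrite /groth_eq /= !(hess_addx0 add_mulP) !(hess_add0x add_mulP) => vE.
rewrite leW_val zW leNgt => /negP; apply.
have /(congr1 val) := vE; rewrite !val_add => {}vE.
apply: le_lt_trans (le_haddl _ (val (mul x' y'))) _; rewrite vE.
(* Each summand multiplies [x] or [y] by an element below the other power; induction handles smaller
   powers, additivity the rest. *)
apply: hadd_lt_opow.
  rewrite (hess_mulC add_mulP).
  apply: (additive_lt_opow (val_mull0 x) (val_mulDl x) (xi := eta)).
    move=> eta' lt'; rewrite (hess_mulC add_mulP) (IHeta _ lt' xiW (etaT _ lt')).
    by rewrite lt_opow ![hadd xi _]haddC lt_hadd2r.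
  by rewrite -(inWK etaW) -ltW_val.
apply: (additive_lt_opow (val_mull0 y) (val_mulDl y) (xi := xi)).
  by move=> xi' lt'; rewrite (IHxi _ lt' _ (xiT _ lt') etaW) lt_opow lt_hadd2r.
by rewrite -(inWK xiW) -ltW_val.
Qed.

(** As [principal lam] is itself a power of omega, smaller ordinals have exponents below its
    exponent; [mul_opow] thus applies to all pairs of terms. *)
Let exps_inW (x : T) t : t \in cnf (val x) -> opow t.1 < principal lam.
Proof.
move=> tx; rewrite lt_opow.
by apply: (lt_opow_coef _ _).1 (valP x) _ _; rewrite cnf_coef_eq0 negbK map_f.
Qed.

Lemma val_mul x y : val (mul x y) = hmul (val x) (val y).
Proof.
rewrite (additive_cnf (val_mull0 y) (val_mulDl y)) /hmul.
apply: eq_big_seq => s /exps_inW sW.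
rewrite (hess_mulC add_mulP) (additive_cnf (val_mull0 _) (val_mulDl _)).
(* On coefficients the [s.2]-fold natural sum is multiplication by [s.2], which distributes over the
   inner sum. *)
apply/cnf_coef_inj/funext => xi; rewrite cnf_coef_iter !cnf_coef_sum big_distrr.
apply: eq_big_seq => t /exps_inW tW.
rewrite (hess_mulC add_mulP) mul_opow // cnf_coef_omul_opow /=.
by rewrite -omul_opow_nat cnf_coef_omul_opow; case: eqP; rewrite ?muln0.
Qed.

End HessenbergProperties.

Theorem corollary9 (lam : Ord)
    (add mul : W (principal lam) -> W (principal lam) -> W (principal lam))
    (add_mulP : hessenberg_properties add mul) :
  (forall add' mul' : W (principal lam) -> W (principal lam) ->
                      W (principal lam),
     hessenberg_properties add' mul' ->
     isomorphic_ops add mul add' mul') /\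
  (forall x y : W (principal lam), val (add x y) = hadd (val x) (val y)) /\
  (forall x y : W (principal lam), val (mul x y) = hmul (val x) (val y)).
Proof.
split=> [add' mul' add_mulP'|]; last first.
  by split=> x y; [apply: val_add add_mulP _ _|apply: val_mul add_mulP _ _].
exists id; split=> // [|x y|x y]; first by exists id.
  by apply: val_inj; rewrite /= (val_add add_mulP) (val_add add_mulP').
by apply: val_inj; rewrite /= (val_mul add_mulP) (val_mul add_mulP').
Qed.
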